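(* Let $(D,\prec,\succ,\{~,~,~\}_{[1]},\{~,~,~\}_{[2]},\{~,~,~\}_{[3]},\{\!\{~,~,~\}\!\}_{[1]},\{\!\{~,~,~\}\!\}_{[2]},\{\!\{~,~,~\}\!\}_{[3]})$ be a dendriform-Yamaguti algebra. Then the quadruple $(D,\cdot_{\mathrm{Tot}},\{~,~,~\}_{\mathrm{Tot}},\{\!\{~,~,~\}\!\}_{\mathrm{Tot}})$ is an associative-Yamaguti algebra, where for $a,b,c\in D$, $$a\cdot_{\mathrm{Tot}}b:=a\prec b+a\succ b,$$ $$\{a,b,c\}_{\mathrm{Tot}}=\{a,b,c\}_{[1]}+\{a,b,c\}_{[2]}+\{a,b,c\}_{[3]},\qquad \{\!\{a,b,c\}\!\}_{\mathrm{Tot}}=\{\!\{a,b,c\}\!\}_{[1]}+\{\!\{a,b,c\}\!\}_{[2]}+\{\!\{a,b,c\}\!\}_{[3]}.$$ Further, if $\psi:D\to D'$ is a homomorphism of dendriform-Yamaguti algebras, then $\psi$ is also a homomorphism of the corresponding associative-Yamaguti algebras.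
   Context: All vector spaces, linear maps and tensor products are over a field $\mathbf{k}$ of characteristic $0$. An associative-Yamaguti algebra is a quadruple $(A,\cdot,\{~,~,~\},\{\!\{~,~,~\}\!\})$ consisting of a vector space $A$ with linear operations $\cdot:A\otimes A\to A$ and $\{~,~,~\},\{\!\{~,~,~\}\!\}:A\otimes A\otimes A\to A$ such that for all $a,b,c,d,e\in A$: (AY1) $(a\cdot b)\cdot c-a\cdot(b\cdot c)+\{a,b,c\}-\{\!\{a,b,c\}\!\}=0$; (AY2) $\{a\cdot b,c,d\}=\{a,b\cdot c,d\}$; (AY3) $\{a,b,c\cdot d\}=\{a,b,c\}\cdot d$; (AY4) $\{\!\{a\cdot b,c,d\}\!\}=a\cdot\{\!\{b,c,d\}\!\}$; (AY5) $\{\!\{a,b\cdot c,d\}\!\}=\{\!\{a,b,c\cdot d\}\!\}$; (AY6) $a\cdot\{b,c,d\}=\{\!\{a,b,c\}\!\}\cdot d$; (AY7) $\{\{a,b,c\},d,e\}=\{a,\{\!\{b,c,d\}\!\},e\}=\{a,b,\{c,d,e\}\}$; (AY8) $\{a,\{b,c,d\},e\}=\{\{\!\{a,b,c\}\!\},d,e\}$; (AY9) $\{\!\{\{\!\{a,b,c\}\!\},d,e\}\!\}=\{\!\{a,\{b,c,d\},e\}\!\}=\{\!\{a,b,\{\!\{c,d,e\}\!\}\}\!\}$; (AY10) $\{\!\{a,\{\!\{b,c,d\}\!\},e\}\!\}=\{\!\{a,b,\{c,d,e\}\}\!\}$; (AY11) $\{a,b,\{\!\{c,d,e\}\!\}\}=\{\!\{\{a,b,c\},d,e\}\!\}$.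 Homomorphisms are linear maps preserving the operations. A dendriform-Yamaguti algebra is a vector space $D$ with linear operations $\prec,\succ:D\otimes D\to D$ and $\{~,~,~\}_{[i]},\{\!\{~,~,~\}\!\}_{[i]}:D\otimes D\otimes D\to D$ ($i=1,2,3$) such that, writing $a*b:=a\prec b+a\succ b$, $\{a,b,c\}_{\mathrm{Tot}}:=\sum_{i=1}^3\{a,b,c\}_{[i]}$ and $\{\!\{a,b,c\}\!\}_{\mathrm{Tot}}:=\sum_{i=1}^3\{\!\{a,b,c\}\!\}_{[i]}$, the following hold for all $a,b,c,d,e\in D$: (DY1) $(a\prec b)\prec c-a\prec(b*c)+\{a,b,c\}_{[1]}-\{\!\{a,b,c\}\!\}_{[1]}=0$; $(a\succ b)\prec c-a\succ(b\prec c)+\{a,b,c\}_{[2]}-\{\!\{a,b,c\}\!\}_{[2]}=0$; $(a*b)\succ c-a\succ(b\succ c)+\{a,b,c\}_{[3]}-\{\!\{a,b,c\}\!\}_{[3]}=0$. (DY2) $\{a\prec b,c,d\}_{[1]}=\{a,b*c,d\}_{[1]}$; $\{a\succ b,c,d\}_{[1]}=\{a,b\prec c,d\}_{[2]}$; $\{a*b,c,d\}_{[2]}=\{a,b\succ c,d\}_{[2]}$; $\{a*b,c,d\}_{[3]}=\{a,b*c,d\}_{[3]}$. (DY3) $\{a,b,c*d\}_{[1]}=\{a,b,c\}_{[1]}\prec d$; $\{a,b,c*d\}_{[2]}=\{a,b,c\}_{[2]}\prec d$; $\{a,b,c\prec d\}_{[3]}=\{a,b,c\}_{[3]}\prec d$;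 $\{a,b,c\succ d\}_{[3]}=\{a,b,c\}_{\mathrm{Tot}}\succ d$. (DY4) $\{\!\{a\prec b,c,d\}\!\}_{[1]}=a\prec\{\!\{b,c,d\}\!\}_{\mathrm{Tot}}$; $\{\!\{a\succ b,c,d\}\!\}_{[1]}=a\succ\{\!\{b,c,d\}\!\}_{[1]}$; $\{\!\{a*b,c,d\}\!\}_{[2]}=a\succ\{\!\{b,c,d\}\!\}_{[2]}$; $\{\!\{a*b,c,d\}\!\}_{[3]}=a\succ\{\!\{b,c,d\}\!\}_{[3]}$. (DY5) $\{\!\{a,b*c,d\}\!\}_{[1]}=\{\!\{a,b,c*d\}\!\}_{[1]}$; $\{\!\{a,b\prec c,d\}\!\}_{[2]}=\{\!\{a,b,c*d\}\!\}_{[2]}$; $\{\!\{a,b\succ c,d\}\!\}_{[2]}=\{\!\{a,b,c\prec d\}\!\}_{[3]}$; $\{\!\{a,b*c,d\}\!\}_{[3]}=\{\!\{a,b,c\succ d\}\!\}_{[3]}$. (DY6) $a\prec\{b,c,d\}_{\mathrm{Tot}}=\{\!\{a,b,c\}\!\}_{[1]}\prec d$; $a\succ\{b,c,d\}_{[1]}=\{\!\{a,b,c\}\!\}_{[2]}\prec d$; $a\succ\{b,c,d\}_{[2]}=\{\!\{a,b,c\}\!\}_{[3]}\prec d$; $a\succ\{b,c,d\}_{[3]}=\{\!\{a,b,c\}\!\}_{\mathrm{Tot}}\succ d$. (DY7) $\{\{a,b,c\}_{[1]},d,e\}_{[1]}=\{a,\{\!\{b,c,d\}\!\}_{\mathrm{Tot}},e\}_{[1]}=\{a,b,\{c,d,e\}_{\mathrm{Tot}}\}_{[1]}$;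 $\{\{a,b,c\}_{[2]},d,e\}_{[1]}=\{a,\{\!\{b,c,d\}\!\}_{[1]},e\}_{[2]}=\{a,b,\{c,d,e\}_{\mathrm{Tot}}\}_{[2]}$; $\{\{a,b,c\}_{[3]},d,e\}_{[1]}=\{a,\{\!\{b,c,d\}\!\}_{[2]},e\}_{[2]}=\{a,b,\{c,d,e\}_{[1]}\}_{[3]}$; $\{\{a,b,c\}_{\mathrm{Tot}},d,e\}_{[2]}=\{a,\{\!\{b,c,d\}\!\}_{[3]},e\}_{[2]}=\{a,b,\{c,d,e\}_{[2]}\}_{[3]}$; $\{\{a,b,c\}_{\mathrm{Tot}},d,e\}_{[3]}=\{a,\{\!\{b,c,d\}\!\}_{\mathrm{Tot}},e\}_{[3]}=\{a,b,\{c,d,e\}_{[3]}\}_{[3]}$. (DY8) $\{a,\{b,c,d\}_{\mathrm{Tot}},e\}_{[1]}=\{\{\!\{a,b,c\}\!\}_{[1]},d,e\}_{[1]}$; $\{a,\{b,c,d\}_{[1]},e\}_{[2]}=\{\{\!\{a,b,c\}\!\}_{[2]},d,e\}_{[1]}$; $\{a,\{b,c,d\}_{[2]},e\}_{[2]}=\{\{\!\{a,b,c\}\!\}_{[3]},d,e\}_{[1]}$; $\{a,\{b,c,d\}_{[3]},e\}_{[2]}=\{\{\!\{a,b,c\}\!\}_{\mathrm{Tot}},d,e\}_{[2]}$; $\{a,\{b,c,d\}_{\mathrm{Tot}},e\}_{[3]}=\{\{\!\{a,b,c\}\!\}_{\mathrm{Tot}},d,e\}_{[3]}$. (DY9) $\{\!\{\{\!\{a,b,c\}\!\}_{[1]},d,e\}\!\}_{[1]}=\{\!\{a,\{b,c,d\}_{\mathrm{Tot}},e\}\!\}_{[1]}=\{\!\{a,b,\{\!\{c,d,e\}\!\}_{\mathrm{Tot}}\}\!\}_{[1]}$;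 $\{\!\{\{\!\{a,b,c\}\!\}_{[2]},d,e\}\!\}_{[1]}=\{\!\{a,\{b,c,d\}_{[1]},e\}\!\}_{[2]}=\{\!\{a,b,\{\!\{c,d,e\}\!\}_{\mathrm{Tot}}\}\!\}_{[2]}$; $\{\!\{\{\!\{a,b,c\}\!\}_{[3]},d,e\}\!\}_{[1]}=\{\!\{a,\{b,c,d\}_{[2]},e\}\!\}_{[2]}=\{\!\{a,b,\{\!\{c,d,e\}\!\}_{[1]}\}\!\}_{[3]}$; $\{\!\{\{\!\{a,b,c\}\!\}_{\mathrm{Tot}},d,e\}\!\}_{[2]}=\{\!\{a,\{b,c,d\}_{[3]},e\}\!\}_{[2]}=\{\!\{a,b,\{\!\{c,d,e\}\!\}_{[2]}\}\!\}_{[3]}$; $\{\!\{\{\!\{a,b,c\}\!\}_{\mathrm{Tot}},d,e\}\!\}_{[3]}=\{\!\{a,\{b,c,d\}_{\mathrm{Tot}},e\}\!\}_{[3]}=\{\!\{a,b,\{\!\{c,d,e\}\!\}_{[3]}\}\!\}_{[3]}$. (DY10) $\{\!\{a,\{\!\{b,c,d\}\!\}_{\mathrm{Tot}},e\}\!\}_{[1]}=\{\!\{a,b,\{c,d,e\}_{\mathrm{Tot}}\}\!\}_{[1]}$; $\{\!\{a,\{\!\{b,c,d\}\!\}_{[1]},e\}\!\}_{[2]}=\{\!\{a,b,\{c,d,e\}_{\mathrm{Tot}}\}\!\}_{[2]}$; $\{\!\{a,\{\!\{b,c,d\}\!\}_{[2]},e\}\!\}_{[2]}=\{\!\{a,b,\{c,d,e\}_{[1]}\}\!\}_{[3]}$;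 $\{\!\{a,\{\!\{b,c,d\}\!\}_{[3]},e\}\!\}_{[2]}=\{\!\{a,b,\{c,d,e\}_{[2]}\}\!\}_{[3]}$; $\{\!\{a,\{\!\{b,c,d\}\!\}_{\mathrm{Tot}},e\}\!\}_{[3]}=\{\!\{a,b,\{c,d,e\}_{[3]}\}\!\}_{[3]}$. (DY11) $\{a,b,\{\!\{c,d,e\}\!\}_{\mathrm{Tot}}\}_{[1]}=\{\!\{\{a,b,c\}_{[1]},d,e\}\!\}_{[1]}$; $\{a,b,\{\!\{c,d,e\}\!\}_{\mathrm{Tot}}\}_{[2]}=\{\!\{\{a,b,c\}_{[2]},d,e\}\!\}_{[1]}$; $\{a,b,\{\!\{c,d,e\}\!\}_{[1]}\}_{[3]}=\{\!\{\{a,b,c\}_{[3]},d,e\}\!\}_{[1]}$; $\{a,b,\{\!\{c,d,e\}\!\}_{[2]}\}_{[3]}=\{\!\{\{a,b,c\}_{\mathrm{Tot}},d,e\}\!\}_{[2]}$; $\{a,b,\{\!\{c,d,e\}\!\}_{[3]}\}_{[3]}=\{\!\{\{a,b,c\}_{\mathrm{Tot}},d,e\}\!\}_{[3]}$. A homomorphism of dendriform-Yamaguti algebras is a linear map preserving all the eight operations. *)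

(* Defs.v *)
From HB Require Import structures.
From mathcomp Require Import all_boot all_order all_algebra.

Set Implicit Arguments.
Unset Strict Implicit.
Unset Printing Implicit Defensive.

Import GRing.Theory.
Local Open Scope ring_scope.

(* Linear maps out of A (x) A and A (x) A (x) A are given as bilinear and
   trilinear maps, i.e. maps that are linear in each argument separately. *)
Definition bilinear_op (k : fieldType) (A : lmodType k) (f : A -> A -> A)
    : Prop :=
  (forall y, linear (fun x => f x y)) /\ (forall x, linear (f x)).

Definition trilinear_op (k : fieldType) (A : lmodType k)
    (f : A -> A -> A -> A) : Prop :=
  [/\ forall y z, linear (fun x => f x y z),
      forall x z, linear (fun y => f x y z) &
      forall x y, linear (f x y)].

(* ay_br is {_, _, _} and ay_dbr is {{_, _, _}}. *)
Record ay_ops (A : Type) : Type := AYOps {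
  ay_mul : A -> A -> A;
  ay_br  : A -> A -> A -> A;
  ay_dbr : A -> A -> A -> A }.

Section AssociativeYamaguti.
Context (k : fieldType) (A : lmodType k) (S : ay_ops A).

Local Notation "a ⋅ b" := (ay_mul S a b) (at level 40, left associativity).
Local Notation p := (ay_br S).
Local Notation q := (ay_dbr S).

Record associative_Yamaguti : Prop := {
  ay_mul_bilinear : bilinear_op (ay_mul S);
  ay_br_trilinear : trilinear_op p;
  ay_dbr_trilinear : trilinear_op q;
  AY1 : forall a b c, (a ⋅ b) ⋅ c - a ⋅ (b ⋅ c) + p a b c - q a b c = 0;
  AY2 : forall a b c d, p (a ⋅ b) c d = p a (b ⋅ c) d;
  AY3 : forall a b c d, p a b (c ⋅ d) = p a b c ⋅ d;
  AY4 : forall a b c d, q (a ⋅ b) c d = a ⋅ q b c d;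
  AY5 : forall a b c d, q a (b ⋅ c) d = q a b (c ⋅ d);
  AY6 : forall a b c d, a ⋅ p b c d = q a b c ⋅ d;
  AY7 : forall a b c d e,
    p (p a b c) d e = p a (q b c d) e /\
    p a (q b c d) e = p a b (p c d e);
  AY8 : forall a b c d e, p a (p b c d) e = p (q a b c) d e;
  AY9 : forall a b c d e,
    q (q a b c) d e = q a (p b c d) e /\
    q a (p b c d) e = q a b (q c d e);
  AY10 : forall a b c d e, q a (q b c d) e = q a b (p c d e);
  AY11 : forall a b c d e, p a b (q c d e) = q (p a b c) d e }.

End AssociativeYamaguti.

Definition ay_hom (k : fieldType) (A A' : lmodType k)
    (S : ay_ops A) (S' : ay_ops A') (psi : A -> A') : Prop :=
  [/\ linear psi,
      forall a b, psi (ay_mul S a b) = ay_mul S' (psi a) (psi b),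
      forall a b c, psi (ay_br S a b c) = ay_br S' (psi a) (psi b) (psi c) &
      forall a b c, psi (ay_dbr S a b c) = ay_dbr S' (psi a) (psi b) (psi c)].

(* dy_bri is {_, _, _}_[i] and dy_dbri is {{_, _, _}}_[i]. *)
Record dy_ops (D : Type) : Type := DYOps {
  dy_prec : D -> D -> D;
  dy_succ : D -> D -> D;
  dy_br1  : D -> D -> D -> D;
  dy_br2  : D -> D -> D -> D;
  dy_br3  : D -> D -> D -> D;
  dy_dbr1 : D -> D -> D -> D;
  dy_dbr2 : D -> D -> D -> D;
  dy_dbr3 : D -> D -> D -> D }.

Definition dy_mulT (k : fieldType) (D : lmodType k) (S : dy_ops D)
    (a b : D) : D := dy_prec S a b + dy_succ S a b.

Definition dy_brT (k : fieldType) (D : lmodType k) (S : dy_ops D)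
    (a b c : D) : D := dy_br1 S a b c + dy_br2 S a b c + dy_br3 S a b c.

Definition dy_dbrT (k : fieldType) (D : lmodType k) (S : dy_ops D)
    (a b c : D) : D := dy_dbr1 S a b c + dy_dbr2 S a b c + dy_dbr3 S a b c.

Definition dy_total (k : fieldType) (D : lmodType k) (S : dy_ops D)
    : ay_ops D := AYOps (dy_mulT S) (dy_brT S) (dy_dbrT S).

Section DendriformYamaguti.
Context (k : fieldType) (D : lmodType k) (S : dy_ops D).

Local Notation "a ≺ b" := (dy_prec S a b) (at level 40, left associativity).
Local Notation "a ≻ b" := (dy_succ S a b) (at level 40, left associativity).
Local Notation "a ∗ b" := (dy_mulT S a b) (at level 40, left associativity).
Local Notation p1 := (dy_br1 S).
Local Notation p2 := (dy_br2 S).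
Local Notation p3 := (dy_br3 S).
Local Notation pT := (dy_brT S).
Local Notation q1 := (dy_dbr1 S).
Local Notation q2 := (dy_dbr2 S).
Local Notation q3 := (dy_dbr3 S).
Local Notation qT := (dy_dbrT S).

Record dendriform_Yamaguti : Prop := {
  dy_prec_bilinear : bilinear_op (dy_prec S);
  dy_succ_bilinear : bilinear_op (dy_succ S);
  dy_br1_trilinear : trilinear_op p1;
  dy_br2_trilinear : trilinear_op p2;
  dy_br3_trilinear : trilinear_op p3;
  dy_dbr1_trilinear : trilinear_op q1;
  dy_dbr2_trilinear : trilinear_op q2;
  dy_dbr3_trilinear : trilinear_op q3;

  DY1_1 : forall a b c, (a ≺ b) ≺ c - a ≺ (b ∗ c) + p1 a b c - q1 a b c = 0;
  DY1_2 : forall a b c, (a ≻ b) ≺ c - a ≻ (b ≺ c) + p2 a b c - q2 a b c = 0;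
  DY1_3 : forall a b c, (a ∗ b) ≻ c - a ≻ (b ≻ c) + p3 a b c - q3 a b c = 0;

  DY2_1 : forall a b c d, p1 (a ≺ b) c d = p1 a (b ∗ c) d;
  DY2_2 : forall a b c d, p1 (a ≻ b) c d = p2 a (b ≺ c) d;
  DY2_3 : forall a b c d, p2 (a ∗ b) c d = p2 a (b ≻ c) d;
  DY2_4 : forall a b c d, p3 (a ∗ b) c d = p3 a (b ∗ c) d;

  DY3_1 : forall a b c d, p1 a b (c ∗ d) = p1 a b c ≺ d;
  DY3_2 : forall a b c d, p2 a b (c ∗ d) = p2 a b c ≺ d;
  DY3_3 : forall a b c d, p3 a b (c ≺ d) = p3 a b c ≺ d;
  DY3_4 : forall a b c d, p3 a b (c ≻ d) = pT a b c ≻ d;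

  DY4_1 : forall a b c d, q1 (a ≺ b) c d = a ≺ qT b c d;
  DY4_2 : forall a b c d, q1 (a ≻ b) c d = a ≻ q1 b c d;
  DY4_3 : forall a b c d, q2 (a ∗ b) c d = a ≻ q2 b c d;
  DY4_4 : forall a b c d, q3 (a ∗ b) c d = a ≻ q3 b c d;

  DY5_1 : forall a b c d, q1 a (b ∗ c) d = q1 a b (c ∗ d);
  DY5_2 : forall a b c d, q2 a (b ≺ c) d = q2 a b (c ∗ d);
  DY5_3 : forall a b c d, q2 a (b ≻ c) d = q3 a b (c ≺ d);
  DY5_4 : forall a b c d, q3 a (b ∗ c) d = q3 a b (c ≻ d);

  DY6_1 : forall a b c d, a ≺ pT b c d = q1 a b c ≺ d;
  DY6_2 : forall a b c d, a ≻ p1 b c d = q2 a b c ≺ d;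
  DY6_3 : forall a b c d, a ≻ p2 b c d = q3 a b c ≺ d;
  DY6_4 : forall a b c d, a ≻ p3 b c d = qT a b c ≻ d;

  DY7_1 : forall a b c d e,
    p1 (p1 a b c) d e = p1 a (qT b c d) e /\
    p1 a (qT b c d) e = p1 a b (pT c d e);
  DY7_2 : forall a b c d e,
    p1 (p2 a b c) d e = p2 a (q1 b c d) e /\
    p2 a (q1 b c d) e = p2 a b (pT c d e);
  DY7_3 : forall a b c d e,
    p1 (p3 a b c) d e = p2 a (q2 b c d) e /\
    p2 a (q2 b c d) e = p3 a b (p1 c d e);
  DY7_4 : forall a b c d e,
    p2 (pT a b c) d e = p2 a (q3 b c d) e /\
    p2 a (q3 b c d) e = p3 a b (p2 c d e);
  DY7_5 : forall a b c d e,
    p3 (pT a b c) d e = p3 a (qT b c d) e /\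
    p3 a (qT b c d) e = p3 a b (p3 c d e);

  DY8_1 : forall a b c d e, p1 a (pT b c d) e = p1 (q1 a b c) d e;
  DY8_2 : forall a b c d e, p2 a (p1 b c d) e = p1 (q2 a b c) d e;
  DY8_3 : forall a b c d e, p2 a (p2 b c d) e = p1 (q3 a b c) d e;
  DY8_4 : forall a b c d e, p2 a (p3 b c d) e = p2 (qT a b c) d e;
  DY8_5 : forall a b c d e, p3 a (pT b c d) e = p3 (qT a b c) d e;

  DY9_1 : forall a b c d e,
    q1 (q1 a b c) d e = q1 a (pT b c d) e /\
    q1 a (pT b c d) e = q1 a b (qT c d e);
  DY9_2 : forall a b c d e,
    q1 (q2 a b c) d e = q2 a (p1 b c d) e /\
    q2 a (p1 b c d) e = q2 a b (qT c d e);
  DY9_3 : forall a b c d e,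
    q1 (q3 a b c) d e = q2 a (p2 b c d) e /\
    q2 a (p2 b c d) e = q3 a b (q1 c d e);
  DY9_4 : forall a b c d e,
    q2 (qT a b c) d e = q2 a (p3 b c d) e /\
    q2 a (p3 b c d) e = q3 a b (q2 c d e);
  DY9_5 : forall a b c d e,
    q3 (qT a b c) d e = q3 a (pT b c d) e /\
    q3 a (pT b c d) e = q3 a b (q3 c d e);

  DY10_1 : forall a b c d e, q1 a (qT b c d) e = q1 a b (pT c d e);
  DY10_2 : forall a b c d e, q2 a (q1 b c d) e = q2 a b (pT c d e);
  DY10_3 : forall a b c d e, q2 a (q2 b c d) e = q3 a b (p1 c d e);
  DY10_4 : forall a b c d e, q2 a (q3 b c d) e = q3 a b (p2 c d e);
  DY10_5 : forall a b c d e, q3 a (qT b c d) e = q3 a b (p3 c d e);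

  DY11_1 : forall a b c d e, p1 a b (qT c d e) = q1 (p1 a b c) d e;
  DY11_2 : forall a b c d e, p2 a b (qT c d e) = q1 (p2 a b c) d e;
  DY11_3 : forall a b c d e, p3 a b (q1 c d e) = q1 (p3 a b c) d e;
  DY11_4 : forall a b c d e, p3 a b (q2 c d e) = q2 (pT a b c) d e;
  DY11_5 : forall a b c d e, p3 a b (q3 c d e) = q3 (pT a b c) d e }.

End DendriformYamaguti.

Record dy_hom (k : fieldType) (D D' : lmodType k)
    (S : dy_ops D) (S' : dy_ops D') (psi : D -> D') : Prop := {
  dy_hom_linear : linear psi;
  dy_hom_prec : forall a b,
    psi (dy_prec S a b) = dy_prec S' (psi a) (psi b);
  dy_hom_succ : forall a b,
    psi (dy_succ S a b) = dy_succ S' (psi a) (psi b);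
  dy_hom_br1 : forall a b c,
    psi (dy_br1 S a b c) = dy_br1 S' (psi a) (psi b) (psi c);
  dy_hom_br2 : forall a b c,
    psi (dy_br2 S a b c) = dy_br2 S' (psi a) (psi b) (psi c);
  dy_hom_br3 : forall a b c,
    psi (dy_br3 S a b c) = dy_br3 S' (psi a) (psi b) (psi c);
  dy_hom_dbr1 : forall a b c,
    psi (dy_dbr1 S a b c) = dy_dbr1 S' (psi a) (psi b) (psi c);
  dy_hom_dbr2 : forall a b c,
    psi (dy_dbr2 S a b c) = dy_dbr2 S' (psi a) (psi b) (psi c);
  dy_hom_dbr3 : forall a b c,
    psi (dy_dbr3 S a b c) = dy_dbr3 S' (psi a) (psi b) (psi c) }.

(* Main.v *)
Require Import Defs.
From HB Require Import structures.
From mathcomp Require Import all_boot all_order all_algebra.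

Import GRing.Theory.
Local Open Scope ring_scope.

(** Each group of dendriform-Yamaguti axioms (DYi) splits the axiom (AYi) into
    pieces: expanding the total operations by multilinearity and summing the
    identities of the group gives (AYi). *)

(** The operations of [D] split the total ones by the argument they mark: [dy_prec] marks the left
    factor, [dy_succ] the right one, and a triple operation of index i its i-th argument. Marking
    one variable of a nested product makes each operation on the path to it mark the slot that
    contains it, and leaves operations off that path total. By multilinearity, each side of an axiom
    is the sum of its marked versions over all its variables, and the dendriform axioms equate these
    versions one variable at a time: three identities for AY1, four for each of AY2 to AY6, five for
    each of AY7 to AY11. The lemmas [dy_total_AY1] to [dy_total_AY11] perform these sums;
    [dy_hom_total] is additivity of [psi]. *)

Lemma add3ACA {V : zmodType} (x1 x2 x3 y1 y2 y3 : V) :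
  (x1 + x2 + x3) + (y1 + y2 + y3) = (x1 + y1) + (x2 + y2) + (x3 + y3).
Proof. by rewrite addrACA (addrACA x1). Qed.

(** Used to regroup the four three-term sums of the expanded AY1 by marked variable, so that each
    group is one of the three DY1 identities. *)
Lemma addB3ACA {V : zmodType} (x1 x2 x3 y1 y2 y3 z1 z2 z3 t1 t2 t3 : V) :
  (x1 + x2 + x3) - (y1 + y2 + y3) + (z1 + z2 + z3) - (t1 + t2 + t3) =
  (x1 - y1 + z1 - t1) + (x2 - y2 + z2 - t2) + (x3 - y3 + z3 - t3).
Proof.
rewrite !opprD (add3ACA x1) (add3ACA (x1 - y1)).
exact: add3ACA.
Qed.

Section LinearOps.
Context {k : fieldType}.

Lemma linear_fun_add {U V : lmodType k} {f : U -> V} :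
  linear f -> forall x y, f (x + y) = f x + f y.
Proof. by move=> lf x y; have := lf 1 x y; rewrite !scale1r. Qed.

Lemma linear_add_fun {U V : lmodType k} {f g : U -> V} :
  linear f -> linear g -> linear (fun x => f x + g x).
Proof. by move=> lf lg a x y; rewrite lf lg scalerDr addrACA. Qed.

Context {A : lmodType k}.

Lemma bilinear_op_add {f g : A -> A -> A} :
  bilinear_op f -> bilinear_op g -> bilinear_op (fun x y => f x y + g x y).
Proof.
by move=> [f1 f2] [g1 g2]; split=> z;
   [exact: linear_add_fun (f1 z) (g1 z) | exact: linear_add_fun (f2 z) (g2 z)].
Qed.

Lemma trilinear_op_add {f g : A -> A -> A -> A} :
  trilinear_op f -> trilinear_op g ->
  trilinear_op (fun x y z => f x y z + g x y z).
Proof.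
move=> [f1 f2 f3] [g1 g2 g3]; split=> u v.
- exact: linear_add_fun (f1 u v) (g1 u v).
- exact: linear_add_fun (f2 u v) (g2 u v).
- exact: linear_add_fun (f3 u v) (g3 u v).
Qed.

Lemma bilinear_opDl {f : A -> A -> A} (fl : bilinear_op f) x x' y :
  f (x + x') y = f x y + f x' y.
Proof. by case: fl => fl _; exact: linear_fun_add (fl y) x x'. Qed.

Lemma bilinear_opDr {f : A -> A -> A} (fl : bilinear_op f) x y y' :
  f x (y + y') = f x y + f x y'.
Proof. by case: fl => _ fl; exact: linear_fun_add (fl x) y y'. Qed.

Lemma trilinear_opD1 {f : A -> A -> A -> A} (fl : trilinear_op f) x x' y z :
  f (x + x') y z = f x y z + f x' y z.
Proof. by case: fl => fl _ _; exact: linear_fun_add (fl y z) x x'. Qed.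

Lemma trilinear_opD2 {f : A -> A -> A -> A} (fl : trilinear_op f) x y y' z :
  f x (y + y') z = f x y z + f x y' z.
Proof. by case: fl => _ fl _; exact: linear_fun_add (fl x z) y y'. Qed.

Lemma trilinear_opD3 {f : A -> A -> A -> A} (fl : trilinear_op f) x y z z' :
  f x y (z + z') = f x y z + f x y z'.
Proof. by case: fl => _ _ fl; exact: linear_fun_add (fl x y) z z'. Qed.

End LinearOps.

Section Total.
Context {k : fieldType} {D : lmodType k} {S : dy_ops D}.
Hypothesis S_dy : dendriform_Yamaguti S.

Local Notation mT := (dy_mulT S).
Local Notation p1 := (dy_br1 S).
Local Notation p2 := (dy_br2 S).
Local Notation p3 := (dy_br3 S).
Local Notation pT := (dy_brT S).
Local Notation q1 := (dy_dbr1 S).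
Local Notation q2 := (dy_dbr2 S).
Local Notation q3 := (dy_dbr3 S).
Local Notation qT := (dy_dbrT S).

Let mTE a b : mT a b = dy_prec S a b + dy_succ S a b. Proof. by []. Qed.
Let pTE a b c : pT a b c = p1 a b c + p2 a b c + p3 a b c. Proof. by []. Qed.
Let qTE a b c : qT a b c = q1 a b c + q2 a b c + q3 a b c. Proof. by []. Qed.

(** Expansions take place in the marked slot: the left one of [dy_prec], the right one of [dy_succ],
    the i-th one of the triple operations of index i. *)
Let precDl := bilinear_opDl (dy_prec_bilinear S_dy).
Let succDl := bilinear_opDl (dy_succ_bilinear S_dy).
Let succDr := bilinear_opDr (dy_succ_bilinear S_dy).
Let p1D1 := trilinear_opD1 (dy_br1_trilinear S_dy).
Let p2D2 := trilinear_opD2 (dy_br2_trilinear S_dy).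
Let p3D3 := trilinear_opD3 (dy_br3_trilinear S_dy).
Let q1D1 := trilinear_opD1 (dy_dbr1_trilinear S_dy).
Let q2D2 := trilinear_opD2 (dy_dbr2_trilinear S_dy).
Let q3D3 := trilinear_opD3 (dy_dbr3_trilinear S_dy).

Lemma dy_total_AY1 a b c :
  mT (mT a b) c - mT a (mT b c) + pT a b c - qT a b c = 0.
Proof.
(* The occurrence numbers select the inner product in the marked slot: [mT a b] under [dy_prec],
   [mT b c] under [dy_succ]. The other copies stay total, as in DY1. *)
rewrite (mTE (mT a b)) (mTE a (mT b c)) {1}(mTE a b) {2}(mTE b c).
rewrite precDl succDr pTE qTE [X in _ - X + _ - _]addrA addB3ACA.
by rewrite (DY1_1 S_dy) (DY1_2 S_dy) (DY1_3 S_dy) !addr0.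
Qed.

Lemma dy_total_AY2 a b c d : pT (mT a b) c d = pT a (mT b c) d.
Proof.
rewrite !pTE {1}(mTE a b) {2}(mTE b c) p1D1 p2D2 addrA.
by rewrite (DY2_1 S_dy) (DY2_2 S_dy) (DY2_3 S_dy) (DY2_4 S_dy).
Qed.

Lemma dy_total_AY3 a b c d : pT a b (mT c d) = mT (pT a b c) d.
Proof.
rewrite (pTE a b (mT c d)) (DY3_1 S_dy) (DY3_2 S_dy) mTE p3D3.
rewrite (DY3_3 S_dy) (DY3_4 S_dy) mTE.
(* Occurrence 1 is the total bracket that [DY3_4] has put under [dy_succ]; occurrence 2 is the one
   under [dy_prec] on the right-hand side. *)
by rewrite {2}(pTE a b c) !precDl !addrA.
Qed.

Lemma dy_total_AY4 a b c d : qT (mT a b) c d = mT a (qT b c d).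
Proof.
rewrite (qTE (mT a b)) {1}(mTE a b) q1D1 (DY4_1 S_dy) (DY4_2 S_dy).
rewrite (DY4_3 S_dy) (DY4_4 S_dy) mTE.
(* The first two occurrences, one from [DY4_1] and its counterpart under [dy_prec] on the right,
   must stay total. *)
by rewrite {3}(qTE b c d) !succDr !addrA.
Qed.

Lemma dy_total_AY5 a b c d : qT a (mT b c) d = qT a b (mT c d).
Proof.
rewrite !qTE {2}(mTE b c) {3}(mTE c d) q2D2 q3D3 !addrA.
by rewrite (DY5_1 S_dy) (DY5_2 S_dy) (DY5_3 S_dy) (DY5_4 S_dy).
Qed.

Lemma dy_total_AY6 a b c d : mT a (pT b c d) = mT (qT a b c) d.
Proof.
rewrite !mTE {2}(pTE b c d) {1}(qTE a b c) !succDr !precDl !addrA.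
by rewrite (DY6_1 S_dy) (DY6_2 S_dy) (DY6_3 S_dy) (DY6_4 S_dy).
Qed.

Lemma dy_total_AY7 a b c d e :
  pT (pT a b c) d e = pT a (qT b c d) e /\
  pT a (qT b c d) e = pT a b (pT c d e).
Proof.
have [l1 r1] := DY7_1 S_dy a b c d e; have [l2 r2] := DY7_2 S_dy a b c d e.
have [l3 r3] := DY7_3 S_dy a b c d e; have [l4 r4] := DY7_4 S_dy a b c d e.
have [l5 r5] := DY7_5 S_dy a b c d e.
rewrite (pTE (pT a b c)) (pTE a (qT b c d)) (pTE a b (pT c d e)).
(* The middle expression stands in both equations, with three copies of [qT b c d] each; copies 2
   and 5 are those inside [p2]. *)
rewrite {1}(pTE a b c) {2 5}(qTE b c d) {3}(pTE c d e) !p1D1 !p2D2 !p3D3 !addrA.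
by rewrite l1 l2 l3 l4 l5 r1 r2 r3 r4 r5.
Qed.

Lemma dy_total_AY8 a b c d e : pT a (pT b c d) e = pT (qT a b c) d e.
Proof.
rewrite (pTE a (pT b c d)) (pTE (qT a b c)) {2}(pTE b c d) {1}(qTE a b c).
rewrite !p1D1 !p2D2 !addrA (DY8_1 S_dy) (DY8_2 S_dy) (DY8_3 S_dy).
by rewrite (DY8_4 S_dy) (DY8_5 S_dy).
Qed.

Lemma dy_total_AY9 a b c d e :
  qT (qT a b c) d e = qT a (pT b c d) e /\
  qT a (pT b c d) e = qT a b (qT c d e).
Proof.
have [l1 r1] := DY9_1 S_dy a b c d e; have [l2 r2] := DY9_2 S_dy a b c d e.
have [l3 r3] := DY9_3 S_dy a b c d e; have [l4 r4] := DY9_4 S_dy a b c d e.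
have [l5 r5] := DY9_5 S_dy a b c d e.
rewrite (qTE (qT a b c)) (qTE a (pT b c d)) (qTE a b (qT c d e)).
(* Likewise, copies 2 and 5 of [pT b c d] are those inside [q2], one in each equation. *)
rewrite {1}(qTE a b c) {2 5}(pTE b c d) {3}(qTE c d e) !q1D1 !q2D2 !q3D3 !addrA.
by rewrite l1 l2 l3 l4 l5 r1 r2 r3 r4 r5.
Qed.

Lemma dy_total_AY10 a b c d e : qT a (qT b c d) e = qT a b (pT c d e).
Proof.
rewrite (qTE a (qT b c d)) (qTE a b (pT c d e)) {2}(qTE b c d) {3}(pTE c d e).
rewrite !q2D2 !q3D3 !addrA (DY10_1 S_dy) (DY10_2 S_dy) (DY10_3 S_dy).
by rewrite (DY10_4 S_dy) (DY10_5 S_dy).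
Qed.

Lemma dy_total_AY11 a b c d e : pT a b (qT c d e) = qT (pT a b c) d e.
Proof.
rewrite (pTE a b (qT c d e)) (qTE (pT a b c)) {3}(qTE c d e) {1}(pTE a b c).
rewrite !p3D3 !q1D1 !addrA (DY11_1 S_dy) (DY11_2 S_dy) (DY11_3 S_dy).
by rewrite (DY11_4 S_dy) (DY11_5 S_dy).
Qed.

Lemma dy_total_associative_Yamaguti : associative_Yamaguti (dy_total S).
Proof.
split.
- exact: bilinear_op_add (dy_prec_bilinear S_dy) (dy_succ_bilinear S_dy).
(* The total is [(p1 + p2) + p3], so the third summand splits off first. *)
- apply: trilinear_op_add (dy_br3_trilinear S_dy).
  exact: trilinear_op_add (dy_br1_trilinear S_dy) (dy_br2_trilinear S_dy).
- apply: trilinear_op_add (dy_dbr3_trilinear S_dy).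
  exact: trilinear_op_add (dy_dbr1_trilinear S_dy) (dy_dbr2_trilinear S_dy).
- exact: dy_total_AY1.
- exact: dy_total_AY2.
- exact: dy_total_AY3.
- exact: dy_total_AY4.
- exact: dy_total_AY5.
- exact: dy_total_AY6.
- exact: dy_total_AY7.
- exact: dy_total_AY8.
- exact: dy_total_AY9.
- exact: dy_total_AY10.
- exact: dy_total_AY11.
Qed.

End Total.

Lemma dy_hom_total {k : fieldType} {D D' : lmodType k} {S : dy_ops D}
    {S' : dy_ops D'} {psi : D -> D'} :
  dy_hom S S' psi -> ay_hom (dy_total S) (dy_total S') psi.
Proof.
case=> psi_lin hprec hsucc h1 h2 h3 g1 g2 g3.
have psiD := linear_fun_add psi_lin.
split=> //= *.
- by rewrite /dy_mulT psiD hprec hsucc.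
- by rewrite /dy_brT !psiD h1 h2 h3.
- by rewrite /dy_dbrT !psiD g1 g2 g3.
Qed.

Theorem theorem6p11 (k : fieldType) (k_char0 : [pchar k] =i pred0)
    (D : lmodType k) (S : dy_ops D) (S_dy : dendriform_Yamaguti S) :
  associative_Yamaguti (dy_total S) /\
  (forall (D' : lmodType k) (S' : dy_ops D'), dendriform_Yamaguti S' ->
   forall psi : D -> D', dy_hom S S' psi ->
   ay_hom (dy_total S) (dy_total S') psi).
Proof.
split; first exact: dy_total_associative_Yamaguti.
by move=> D' S' _ psi; exact: dy_hom_total.
Qed.
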